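(* Let $d\ge 2$. The pentagram map $T_{cor}:\mathcal P_n^{cor}\to\mathcal P_n^{cor}$ on corrugated $n$-gons in $\mathbb{RP}^d$ is, for any $m=1,\dots,d-1$, a restriction of the dented pentagram map $T_m$ from the space $\mathcal P_n$ of generic twisted $n$-gons in $\mathbb{RP}^d$ to the space $\mathcal P_n^{cor}$ of corrugated ones (or differs from it by a shift in vertex indices). In particular, these restrictions of $T_m$ for different $m$ coincide modulo an index shift.
   Context: A twisted $n$-gon in $\mathbb{RP}^d$ with monodromy $M\in SL_{d+1}(\mathbb R)$ is a sequence $(v_k)_{k\in\mathbb Z}$ of points of $\mathbb{RP}^d$ with $v_{k+n}=Mv_k$ for all $k$. $\mathcal P_n$ denotes the space of generic twisted $n$-gons (no $d+1$ consecutive vertices lie in one hyperplane) modulo projective equivalence (the action of $SL_{d+1}(\mathbb R)$). All maps are generically defined. A twisted polygon $(v_k)$ is corrugated if for every $k\in\mathbb Z$ the vertices $v_k,v_{k+1},v_{k+d},v_{k+d+1}$ span a projective two-dimensional plane. $\mathcal P_n^{cor}\subset\mathcal P_n$ is the space of projective equivalence classes of generic corrugated $n$-gons. The corrugated pentagram map is $T_{cor}v_k:=(v_k,v_{k+d})\cap(v_{k+1},v_{k+d+1})$, where $(\cdot,\cdot)$ denotes the line through two points; it sends corrugated polygons to corrugated ones. Dented pentagram map: for $1\le m\le d-1$ let $P_k$ be the hyperplane through the $d$ vertices $v_k,\dots,v_{k+m-1},v_{k+m+1},\dots,v_{k+d}$ (all vertices from $v_k$ to $v_{k+d}$ except $v_{k+m}$).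 Then $T_mv_k:=P_k\cap P_{k+1}\cap\dots\cap P_{k+d-1}$. A shift in vertex indices is a map $(v_k)_{k}\mapsto(v_{k+s})_{k}$ for some fixed $s\in\mathbb Z$. *)

(* Defs.v *)
From HB Require Import structures.
From mathcomp Require Import all_boot all_order all_algebra.
From mathcomp Require Import boolp classical_sets reals.

Set Implicit Arguments.
Unset Strict Implicit.
Unset Printing Implicit Defensive.

Import GRing.Theory.
Local Open Scope classical_set_scope.
Local Open Scope ring_scope.

(* Projective subspaces of RP^d are linear subspaces of R^(d+1): a flat of
   projective dimension j is a subspace of dimension j + 1, the span of flats
   is their sum, and their intersection is the intersection of subspaces. *)
Notation flat R d := {vspace 'cV[R]_d.+1}.

Record RP (R : realType) (d : nat) :=
  ProjPoint { line_of :> flat R d; line_ofP : \dim line_of == 1%N }.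

HB.instance Definition _ (R : realType) (d : nat) :=
  [isSub for @line_of R d].

Definition mx_act (R : realType) (d : nat) (A : 'M[R]_d.+1) (U : flat R d) :
  flat R d := (linfun (mulmx A) @: U)%VS.

Definition polygon (R : realType) (d : nat) := int -> RP R d.

Section Polygons.
Variables (R : realType) (d : nat).
Implicit Types (v w : polygon R d) (k s : int) (m n : nat).

Definition twisted n v : Prop :=
  exists2 M : 'M[R]_d.+1, \det M = 1 &
    forall k, v (k + n%:Z) = mx_act M (v k) :> flat R d.

Definition generic v : Prop :=
  forall k (H : flat R d), \dim H = d ->
    ~ (forall i : 'I_d.+1, (v (k + i%:Z)%R <= H)%VS).

Definition corrugated v : Prop :=
  forall k,
    \dim (v k + v (k + 1)%R + v (k + d%:Z)%R + v (k + d%:Z + 1)%R)%VS = 3%N.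

Definition shift s v : polygon R d := fun k => v (k + s).

(* The polygon whose k-th vertex is F k, when every F k is a single point. *)
Definition polygon_of (F : int -> flat R d) : option (polygon R d) :=
  if pselect (forall k, \dim (F k) == 1%N) is left F1
  then Some (fun k => ProjPoint (F1 k)) else None.

Definition corrugated_map v : option (polygon R d) :=
  polygon_of (fun k =>
    (v k + v (k + d%:Z)%R) :&: (v (k + 1)%R + v (k + d%:Z + 1)%R))%VS.

Definition dented_hyperplane m v k : flat R d :=
  (\sum_(i < d.+1 | i != m :> nat) v (k + i%:Z)%R)%VS.

Definition dented_map m v : option (polygon R d) :=
  polygon_of (fun k =>
    \bigcap_(i < d) dented_hyperplane m v (k + i%:Z)%R)%VS.

Definition proj_class v : set (polygon R d) :=
  [set w | exists2 A : 'M[R]_d.+1, \det A = 1 &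
             forall k, w k = mx_act A (v k) :> flat R d].

Definition Pn n : set (set (polygon R d)) :=
  proj_class @` [set v | twisted n v /\ generic v].

Definition Pcor n : set (set (polygon R d)) :=
  proj_class @` [set v | [/\ twisted n v, generic v & corrugated v]].

(* The partial self-map of a space X of projective classes induced by a
   partial map T of polygons that commutes with projective transformations.
   It is undefined at p when the image of p is not in X, e.g. when T takes
   the polygons of p to polygons that are not generic. *)
Definition induced (X : set (set (polygon R d)))
    (T : polygon R d -> option (polygon R d)) (p : set (polygon R d)) :
    option (set (polygon R d)) :=
  let q := [set w | exists2 v, p v & T v = Some w] in
  if `[< X p /\ X q >] then Some q else None.

Definition T_cor n := induced (Pcor n) corrugated_map.

Definition T_dented n m := induced (Pn n) (dented_map m).

Definition shift_class s (p : set (polygon R d)) : set (polygon R d) :=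
  shift s @` p.

End Polygons.

(* Main.v *)
Require Import Defs.
From mathcomp Require Import all_boot all_order all_algebra.
From mathcomp Require Import boolp classical_sets reals.
From mathcomp Require Import zify.

(** Let v be a generic corrugated polygon, and write P_j for the hyperplane
    spanned by v_j, ..., v_(j+d) with the centre v_c, c = j + m, left out.

    The key point is that P_j contains far more vertices than those that
    define it: it contains every v_l with 0 < |l - c| < d
    ([dented_hyperplane_near]). Indeed four points v_k, v_(k+1), v_(k+d),
    v_(k+d+1) lie in a plane, and genericity makes any three of them that
    leave out v_k or v_(k+d+1) span it. Hence a hyperplane that contains the
    first three contains the fourth, and one that contains the last three
    contains the first. Sliding such quadruples away from P_j in both
    directions adds one vertex at a time until a quadruple meets the missing
    centre. So P_j depends on m only through its centre, and this is
    why the maps T_m agree up to a shift of indices.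

    The intersection of P_k, ..., P_(k+d-1) involves the centres v_c with
    k + m <= c < k + m + d. Each of these d hyperplanes contains all of these
    centres except its own, so the hyperplanes are independent and meet in at
    most a point ([dim_dented_cap]). The point w_(k+m-1) of the corrugated
    map lies on the chords (v_(k+m-1), v_(k+m-1+d)) and (v_(k+m), v_(k+m+d)).
    The ends of the first chord are near every centre except the last one,
    and the ends of the second are near every centre except the first one,
    so each hyperplane contains one of the two chords. Hence
    T_m v_k = w_(k+m-1) ([dented_cap]), a shift by m - 1.

    On projective classes one must also compare the domains: T_m is defined
    where its image is generic, T_cor where its image is generic and
    corrugated. These agree because a generic image of T_cor is automatically
    corrugated ([corrugated_map_corrugated]). *)

Set Implicit Arguments.
Unset Strict Implicit.
Unset Printing Implicit Defensive.

Import Order.TTheory GRing.Theory Num.Theory.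
Local Open Scope ring_scope.

(** * Spans of vertices of a generic polygon *)

Lemma exists_hyperplane_above (K : fieldType) (vT : vectType K)
    (U : {vspace vT}) :
  (\dim U < dim vT)%N ->
  exists2 H : {vspace vT}, \dim H = (dim vT).-1 & (U <= H)%VS.
Proof.
move=> ltU; pose e := vpick (U^C)%VS.
have dimC := dimv_compl U.
have e0 : e != 0.
  by rewrite vpick0 -dimv_eq0 dimC -lt0n subn_gt0 dimvf.
exists (U + (U^C :\: <[e]>))%VS; last exact: addvSl.
have dimD := dimv_cap_compl (U^C)%VS <[e]>%VS.
have capE : (U^C :&: <[e]>)%VS = <[e]>%VS.
  by apply/capv_idPr; rewrite -memvE memv_pick.
have cap0 : (U :&: (U^C :\: <[e]>))%VS = 0%VS.
  by apply/eqP; rewrite -subv0 -(capv_compl U) capvS ?diffvSl.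
rewrite capE dim_vline e0 dimC dimvf in dimD.
rewrite dimv_disjoint_sum //; lia.
Qed.

Section Flats.
Context {R : realType} {d : nat}.
Implicit Types (v w u : polygon R d) (k l s : int) (p : set (polygon R d)).

Lemma dim_point (x : RP R d) : \dim x = 1%N.
Proof. exact/eqP/line_ofP. Qed.

Lemma dim_RP_space : dim 'cV[R]_d.+1 = d.+1.
Proof. by rewrite /dim /= muln1. Qed.

Lemma polygon_ext v w : (forall k, v k = w k :> flat R d) -> v = w.
Proof. by move=> vw; apply/funext => k; apply/val_inj/vw. Qed.

Lemma polygon_of_eq (F : int -> flat R d) w :
  (forall k, F k = w k) -> polygon_of F = Some w.
Proof.
move=> Fw; rewrite /polygon_of; case: pselect => [F1|[] k].
  by congr Some; apply: polygon_ext => k /=.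
by rewrite Fw dim_point.
Qed.

Lemma polygon_of_dim1 (F : int -> flat R d) :
  (forall k, \dim (F k) = 1%N) ->
  exists2 w, polygon_of F = Some w & forall k, w k = F k :> flat R d.
Proof.
move=> F1; have F1b k : \dim (F k) == 1%N by apply/eqP.
by exists (fun k => ProjPoint (F1b k)) => //; apply: polygon_of_eq.
Qed.

Lemma dim_sum_points_le v k (s : seq nat) :
  (\dim (\sum_(i <- s) v (k + i%:Z)%R)%VS <= size s)%N.
Proof.
elim: s => [|i s IHs]; first by rewrite big_nil dimv0.
rewrite big_cons /=; apply: leq_trans (dimv_add_leqif _ _) _.
by rewrite dim_point.
Qed.

(** Genericity forbids a hyperplane through d + 1 consecutive vertices; this
    is its usable form, that any subset of such a window is independent.
    The whole window spans the space, as otherwise some hyperplane would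
    contain its span; a subset and its complement span at most as many
    dimensions as they have points, so neither can fall short. *)
Lemma generic_dim_sum v k (s : seq nat) :
  generic v -> uniq s -> all (gtn d.+1) s ->
  \dim (\sum_(i <- s) v (k + i%:Z)%R)%VS = size s.
Proof.
move=> gv us /allP s_lt.
set W := fun r : seq nat => (\sum_(i <- r) v (k + i%:Z)%R)%VS.
have full : \dim (W (iota 0 d.+1)) = d.+1.
  have := dim_sum_points_le v k (iota 0 d.+1).
  rewrite -/(W _) size_iota leq_eqVlt => /predU1P[//|lt].
  have [|H dimH sWH] := @exists_hyperplane_above _ _ (W (iota 0 d.+1)).
    by rewrite dim_RP_space.
  rewrite dim_RP_space /= in dimH.
  have [] := gv k H dimH => i; apply: subv_trans sWH.
  have iP : (i : nat) \in iota 0 d.+1 by rewrite mem_iota /= add0n.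
  by rewrite /W (big_rem _ iP) /= addvSl.
pose r := [seq i <- iota 0 d.+1 | i \notin s].
have perm : perm_eq (iota 0 d.+1) (s ++ r).
  apply: uniq_perm; first exact: iota_uniq.
    rewrite cat_uniq us filter_uniq ?iota_uniq // andbT /=.
    by apply/hasPn => i; rewrite mem_filter => /andP[].
  move=> i; rewrite mem_cat mem_filter mem_iota /= add0n.
  by case: (boolP (i \in s)) => // /s_lt.
have := full; rewrite /W (perm_big _ perm) big_cat /= => sumE.
have := perm_size perm; rewrite size_iota size_cat => sizeE.
have := dimv_add_leqif (W s) (W r) => -[le_add _].
rewrite /W sumE in le_add.
apply/eqP; rewrite eqn_leq dim_sum_points_le -(leq_add2r (size r)) -sizeE /=.
by apply: leq_trans le_add _; rewrite leq_add2l dim_sum_points_le.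
Qed.

(** The corrugated map intersects consecutive lines of this family. *)
Definition chord v k : flat R d := (v k + v (k + d%:Z)%R)%VS.

Section Generic.
Variable v : polygon R d.
Hypotheses (d_gt1 : (1 < d)%N) (gv : generic v).

Lemma dim_chord k : \dim (chord v k) = 2%N.
Proof.
rewrite /chord -{1}[k]addr0.
have := @generic_dim_sum v k [:: 0; d]%N gv.
rewrite !big_cons big_nil addv0 /=; apply; rewrite ?inE; lia.
Qed.

Lemma dim_window_first k : \dim (v k + v (k + 1)%R + v (k + d%:Z)%R)%VS = 3%N.
Proof.
have := @generic_dim_sum v k [:: 0; 1; d]%N gv.
rewrite !big_cons big_nil addv0 addvA /= addr0; apply; rewrite /= ?inE; lia.
Qed.

Lemma dim_window_last k :
  \dim (v (k + 1)%R + v (k + d%:Z)%R + v (k + d%:Z + 1)%R)%VS = 3%N.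
Proof.
have := @generic_dim_sum v (k + 1)%R [:: 0; d.-1; d]%N gv.
rewrite !big_cons big_nil addv0 addvA /= addr0.
have -> : k + 1 + d.-1%:Z = k + d%:Z by lia.
have -> : k + 1 + d%:Z = k + d%:Z + 1 by lia.
by apply; rewrite /= ?inE; lia.
Qed.

Lemma dented_hyperplane_vertex m k (i : nat) :
  (i <= d)%N -> i != m -> (v (k + i%:Z)%R <= dented_hyperplane m v k)%VS.
Proof.
move=> le_id nim; pose j := @Ordinal d.+1 i le_id.
by apply: (@sumv_sup _ _ _ j) => //; apply: subvv.
Qed.

Lemma dented_hyperplaneE m k :
  dented_hyperplane m v k =
  (\sum_(i <- [seq i <- iota 0 d.+1 | i != m]) v (k + i%:Z)%R)%VS.
Proof.
by rewrite big_filter (_ : iota 0 d.+1 = index_iota 0 d.+1) // big_mkord.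
Qed.

(** This makes the hyperplanes P_(c-m) behave as dual vectors to the points
    v_c that they leave out. *)
Lemma dented_vertex_cap m k : (m <= d)%N ->
  (v (k + m%:Z)%R :&: dented_hyperplane m v k = 0)%VS.
Proof.
move=> le_md; set r := [seq i <- iota 0 d.+1 | i != m].
have r_uniq : uniq r by rewrite filter_uniq ?iota_uniq.
have r_lt : all (gtn d.+1) r.
  by apply/allP => i; rewrite mem_filter mem_iota /= => /andP[].
have dimP : \dim (dented_hyperplane m v k) = size r.
  by rewrite dented_hyperplaneE generic_dim_sum.
have := @generic_dim_sum v k (m :: r) gv.
rewrite /= r_uniq r_lt ltnS le_md mem_filter eqxx big_cons.
rewrite -dented_hyperplaneE => /(_ isT isT) dimS.
have := dimv_sum_cap (v (k + m%:Z)%R) (dented_hyperplane m v k).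
rewrite dimS dimP dim_point add1n -[RHS]addn0 => /addnI/eqP.
by rewrite dimv_eq0 => /eqP.
Qed.

End Generic.

(** * Dented hyperplanes of a corrugated polygon *)

Section Corrugated.
Variable v : polygon R d.
Hypotheses (d_gt1 : (1 < d)%N) (gv : generic v) (cv : corrugated v).

(** The first three points of a corrugated quadruple are independent, hence
    already span its plane. *)
Lemma corrugated_last k :
  (v (k + d%:Z + 1)%R <= v k + v (k + 1)%R + v (k + d%:Z)%R)%VS.
Proof.
rewrite -[X in (_ <= X)%VS]
  (_ : v k + v (k + 1)%R + v (k + d%:Z)%R + v (k + d%:Z + 1)%R = _)%VS.
  exact: addvSr.
by apply/esym/eqP; rewrite eqEdim addvSl cv (dim_window_first d_gt1 gv).
Qed.

(** The mirror image of [corrugated_last]: the last three points span the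
    plane of the quadruple. *)
Lemma corrugated_first k :
  (v k <= v (k + 1)%R + v (k + d%:Z)%R + v (k + d%:Z + 1)%R)%VS.
Proof.
rewrite -[X in (_ <= X)%VS]
  (_ : v k + (v (k + 1)%R + v (k + d%:Z)%R + v (k + d%:Z + 1)%R) = _)%VS.
  exact: addvSl.
by apply/esym/eqP; rewrite eqEdim addvSr !addvA cv (dim_window_last d_gt1 gv).
Qed.

(** Two lines in a common plane, distinct because together they span it. *)
Lemma dim_corrugated_cap k : \dim (chord v k :&: chord v (k + 1)%R)%VS = 1%N.
Proof.
have := dimv_sum_cap (chord v k) (chord v (k + 1)%R).
rewrite !(dim_chord d_gt1 gv) /chord.
have -> : k + 1 + d%:Z = k + d%:Z + 1 by lia.
have -> : (v k + v (k + d%:Z)%R + (v (k + 1)%R + v (k + d%:Z + 1)%R) =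
  v k + v (k + 1)%R + v (k + d%:Z)%R + v (k + d%:Z + 1)%R)%VS.
  by rewrite !addvA -(addvA (v k)) (addvC (v (k + d%:Z)%R)) addvA.
by rewrite cv; lia.
Qed.

Lemma corrugated_map_defined :
  exists2 w, corrugated_map v = Some w
    & forall k, w k = (chord v k :&: chord v (k + 1)%R)%VS :> flat R d.
Proof.
have [w wE wk] := polygon_of_dim1 (fun k => dim_corrugated_cap k).
exists w => //; rewrite -wE; congr polygon_of; apply/funext => k.
by rewrite /chord addrAC.
Qed.

Section Dented.
Variable m : nat.
Hypothesis m_bounds : (0 < m < d)%N.

(** Beyond the vertices of the window, v_(k+i) lies in the plane of
    v_(k+i-d-1), v_(k+i-d), v_(k+i-1), which are already in the hyperplane.
    The argument stops at i = d + m, where v_(k+m) would be needed. *)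
Lemma dented_hyperplane_right k (i : nat) : i != m -> (i < d + m)%N ->
  (v (k + i%:Z)%R <= dented_hyperplane m v k)%VS.
Proof.
elim/ltn_ind: i => i IHi nim lt_i.
have [le_id|lt_di] := leqP i d; first exact: dented_hyperplane_vertex.
have -> : k + i%:Z = k + (i - d.+1)%N%:Z + d%:Z + 1 by lia.
apply: subv_trans (corrugated_last _) _; rewrite !subv_add.
have -> : k + (i - d.+1)%N%:Z + 1 = k + (i - d)%N%:Z by lia.
have -> : k + (i - d.+1)%N%:Z + d%:Z = k + i.-1%:Z by lia.
by rewrite !IHi //; lia.
Qed.

(** As on the right, but here it is the vertex v_(k+d-i) of the window that
    becomes the missing v_(k+m), when i = d - m. *)
Lemma dented_hyperplane_left k (i : nat) : (i < d - m)%N ->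
  (v (k - i%:Z)%R <= dented_hyperplane m v k)%VS.
Proof.
elim: i => [|i IHi] lt_i.
  by rewrite subr0 -{1}[k]addr0; apply: dented_hyperplane_right; lia.
apply: subv_trans (corrugated_first _) _; rewrite !subv_add.
have -> : k - i.+1%:Z + 1 = k - i%:Z by lia.
have -> : k - i.+1%:Z + d%:Z = k + (d - i.+1)%N%:Z by lia.
have -> : k + (d - i.+1)%N%:Z + 1 = k + (d - i)%N%:Z by lia.
by rewrite IHi ?dented_hyperplane_right //; lia.
Qed.

Lemma dented_hyperplane_near k l : l != k + m%:Z ->
  (`|(l - (k + m%:Z))%R| < d)%N -> (v l <= dented_hyperplane m v k)%VS.
Proof.
move=> nl lt_l; have [ge_lk|lt_lk] := lerP k l.
  have -> : l = k + `|(l - k)%R|%N%:Z by lia.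
  by apply: dented_hyperplane_right; lia.
have -> : l = k - `|(l - k)%R|%N%:Z by lia.
by apply: dented_hyperplane_left; lia.
Qed.

(** The span S of the d consecutive centres has dimension d, so it suffices
    that the intersection meets S trivially. If a combination of the centres
    lies in every P_(k+i), then its i-th term does too, since P_(k+i) contains
    all the other terms; but P_(k+i) misses its own centre. *)
Lemma dim_dented_cap k :
  (\dim (\bigcap_(i < d) dented_hyperplane m v (k + i%:Z)%R)%VS <= 1)%N.
Proof.
set U := (\bigcap_(i < d) _)%VS.
pose S := (\sum_(i < d) v (k + m%:Z + i%:Z)%R)%VS.
have dimS : \dim S = d.
  have -> : S = (\sum_(0 <= i < d) v (k + m%:Z + i%:Z)%R)%VS.
    by rewrite big_mkord.
  rewrite (generic_dim_sum _ gv) ?size_iota ?subn0 ?iota_uniq //.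
  by apply/allP => i; rewrite mem_iota /=; lia.
have US0 : (U :&: S)%VS = 0%VS.
  apply/eqP; rewrite -subv0; apply/subvP => x.
  rewrite memv_cap memv0 => /andP[xU /memv_sumP[u uv xE]].
  rewrite xE big1 // => i _; apply/eqP.
  rewrite -memv0 -(@dented_vertex_cap v gv m (k + i%:Z)); last lia.
  have -> : k + i%:Z + m%:Z = k + m%:Z + i%:Z by lia.
  rewrite memv_cap uv //=.
  have -> : u i = x - \sum_(j < d | j != i) u j.
    by rewrite xE (bigD1 i) //= addrK.
  rewrite rpredB //.
    by move/subv_bigcapP: (subvv U) => /(_ i isT)/subvP; apply.
  apply: rpred_sum => j nji; have := uv j isT; apply/subvP.
  apply: dented_hyperplane_near; first by move: nji; rewrite -val_eqE /=; lia.
  by have := ltn_ord i; have := ltn_ord j; lia.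
have := dimvS (subvf (U + S)%VS); rewrite dimv_disjoint_sum // dimvf.
rewrite dim_RP_space dimS; lia.
Qed.

(** By the dimension bound, it is enough that the point on the right lies in
    each hyperplane P_(k+i). The first chord lies in all of them but the last
    and the second chord in all of them but the first; as d >= 2, every one
    contains at least one of the chords. *)
Lemma dented_cap k :
  (\bigcap_(i < d) dented_hyperplane m v (k + i%:Z)%R)%VS =
  (chord v (k + (m%:Z - 1))%R :&: chord v (k + (m%:Z - 1) + 1)%R)%VS.
Proof.
apply/esym/eqP; rewrite eqEdim dim_corrugated_cap dim_dented_cap andbT.
apply/subv_bigcapP => i _.
(* The second chord starts at v_(k+m), which is the centre of P_k. *)
have [i0|i0] := posnP i.
  apply: subv_trans (capvSl _ _) _; rewrite subv_add.
  by rewrite !dented_hyperplane_near //; lia.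
apply: subv_trans (capvSr _ _) _; rewrite subv_add.
by rewrite !dented_hyperplane_near //; have := ltn_ord i; lia.
Qed.

Lemma dented_map_corrugated w : corrugated_map v = Some w ->
  dented_map m v = Some (shift (m%:Z - 1) w).
Proof.
have [w' vw' wk] := corrugated_map_defined; rewrite vw' => -[<-].
apply: polygon_of_eq => k.
by rewrite dented_cap /shift wk.
Qed.

End Dented.

(** The points w_k and w_(k+1) lie on one chord of v, w_(k+d) and w_(k+d+1)
    on another, and these two chords share the vertex v_(k+d+1), so all four
    points lie in one plane. *)
Lemma corrugated_map_corrugated w :
  corrugated_map v = Some w -> generic w -> corrugated w.
Proof.
have [w' vw' wk] := corrugated_map_defined; rewrite vw'; case=> <- gw k.
apply/eqP; rewrite eqn_leq; apply/andP; split; last first.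
  by rewrite -(dim_window_first d_gt1 gw k) dimvS ?addvSl.
have chord_end : v (k + d%:Z + 1) = v (k + 1 + d%:Z) by congr v; lia.
pose B := (chord v (k + 1)%R + v (k + d%:Z + 1 + d%:Z)%R)%VS.
have le1 : (chord v (k + 1)%R <= B)%VS by apply: addvSl.
have le2 : (chord v (k + d%:Z + 1)%R <= B)%VS.
  by rewrite /B /chord chord_end -addvA addvSr.
apply: (@leq_trans (\dim B)).
  apply: dimvS; rewrite !subv_add !wk.
  rewrite (subv_trans (capvSr _ _) le1) (subv_trans (capvSl _ _) le1).
  by rewrite (subv_trans (capvSr _ _) le2) (subv_trans (capvSl _ _) le2).
have [+ _] := dimv_add_leqif (chord v (k + 1)) (v (k + d%:Z + 1 + d%:Z)).
by rewrite (dim_chord d_gt1 gv) dim_point.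
Qed.

End Corrugated.

(** * Projective classes and index shifts *)

Section Projective.
Variable A : 'M[R]_d.+1.
Hypothesis detA : \det A = 1.

Lemma det1_unitmx : A \in unitmx.
Proof. by rewrite unitmxE detA unitr1. Qed.

Lemma mx_act_lker0 : lker (linfun (mulmx A) : 'End('cV[R]_d.+1)) == 0%VS.
Proof.
apply/lker0P => x y; rewrite !lfunE /= => Axy.
by rewrite -(mulKmx det1_unitmx x) Axy mulKmx ?det1_unitmx.
Qed.

Lemma dim_mx_act (U : flat R d) : \dim (mx_act A U) = \dim U.
Proof. by apply: limg_dim_eq; rewrite (eqP mx_act_lker0) capv0. Qed.

Lemma mx_act_comp B (U : flat R d) : mx_act A (mx_act B U) = mx_act (A *m B) U.
Proof.
rewrite /mx_act -limg_comp; congr (_ @: _)%VS; apply/lfunP => x.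
by rewrite comp_lfunE !lfunE /= mulmxA.
Qed.

Lemma mx_actK (U : flat R d) : mx_act (invmx A) (mx_act A U) = U.
Proof.
rewrite /mx_act -limg_comp (_ : (_ \o _)%VF = \1%VF) ?lim1g //.
by apply/lfunP => x; rewrite comp_lfunE !lfunE /= mulKmx ?det1_unitmx.
Qed.

Lemma det_invmx1 : \det (invmx A) = 1.
Proof. by rewrite det_inv detA invr1. Qed.

End Projective.

Lemma proj_class_refl v : proj_class v v.
Proof.
exists 1%:M => [|k]; first exact: det1.
rewrite /mx_act (_ : linfun _ = \1%VF) ?lim1g //.
by apply/lfunP => x; rewrite !lfunE /= mul1mx.
Qed.

Section Classes.
Variables v w : polygon R d.
Hypothesis vw : proj_class v w.

Lemma proj_class_twisted n : twisted n v -> twisted n w.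
Proof.
have [A detA wE] := vw; case=> M detM vn.
exists (A *m M *m invmx A) => [|k].
  by rewrite !det_mulmx detA detM det_invmx1 // !mulr1.
rewrite !wE vn !mx_act_comp; congr mx_act.
by rewrite mulmxKV // det1_unitmx.
Qed.

Lemma proj_class_generic : generic v -> generic w.
Proof.
have [A detA wE] := vw; move=> gv k H dimH wH.
apply: (gv k (mx_act (invmx A) H)) => [|i].
  by rewrite dim_mx_act ?det_invmx1.
by rewrite -(mx_actK detA (v _)) -wE limgS.
Qed.

Lemma proj_class_corrugated : corrugated v -> corrugated w.
Proof.
have [A detA wE] := vw; move=> cv k.
by rewrite !wE /mx_act -!limgD dim_mx_act ?cv.
Qed.

End Classes.

Lemma shift_comp s1 s2 v : shift s1 (shift s2 v) = shift (s1 + s2) v.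
Proof. by apply/funext => k; rewrite /shift addrA. Qed.

Lemma shift0 v : shift 0 v = v.
Proof. by apply/funext => k; rewrite /shift addr0. Qed.

Lemma shift_class_comp s1 s2 p :
  shift_class s1 (shift_class s2 p) = shift_class (s1 + s2) p.
Proof.
rewrite /shift_class image_comp; apply: eq_imagel => v _.
exact: shift_comp.
Qed.

Lemma shift_class0 p : shift_class 0 p = p.
Proof.
by rewrite /shift_class (_ : shift 0 = id) ?image_id //; apply/funext/shift0.
Qed.

Lemma shift_proj_class s v :
  shift_class s (proj_class v) = proj_class (shift s v).
Proof.
apply/seteqP; split => [_ [w [A detA wE] <-]|w [A detA wE]].
  by exists A => // k; rewrite wE.
exists (shift (- s) w); last by rewrite shift_comp subrr shift0.
by exists A => // k; rewrite /shift wE /shift subrK.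
Qed.

Lemma shift_generic s v : generic v -> generic (shift s v).
Proof.
move=> gv k H dimH sH; apply: (gv (k + s) H dimH) => i.
by have := sH i; rewrite /shift addrAC.
Qed.

Lemma shift_twisted n s v : twisted n v -> twisted n (shift s v).
Proof.
by case=> M detM vn; exists M => // k; rewrite /shift addrAC vn.
Qed.

(** All representatives of a class in Pcor n are themselves twisted, generic
    and corrugated, so the images of the class under the two maps are shifts
    of each other. What remains is that the image under T_m is a class in
    Pn n exactly when the image under T_cor is one in Pcor n. *)
Lemma T_dented_T_cor n m p : (1 < d)%N -> (0 < m < d)%N -> Pcor n p ->
  T_dented n m p = omap (shift_class (m%:Z - 1)) (T_cor n p).
Proof.
move=> d_gt1 m_bounds Pp; set s : int := m%:Z - 1.
have pP v : p v -> [/\ twisted n v, generic v & corrugated v].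
  have [u [tu gu cu] <-] := Pp => uv.
  split; [exact: (proj_class_twisted uv tu)|exact: (proj_class_generic uv gu)|].
  exact: (proj_class_corrugated uv cu).
rewrite /T_dented /T_cor /induced.
set q := (X in Pn n p /\ Pn n X); set q' := (X in Pcor n p /\ Pcor n X).
have qE : q = shift_class s q'.
  apply/seteqP; split => [w [v pv]|_ [w [v pv vw] <-]]; last first.
    have [_ gv cv] := pP _ pv.
    by exists v => //; apply: (dented_map_corrugated d_gt1 gv cv).
  have [_ gv cv] := pP _ pv.
  have [w' vw' _] := corrugated_map_defined d_gt1 gv cv.
  rewrite (dented_map_corrugated d_gt1 gv cv m_bounds vw') => -[<-].
  by exists w' => //; exists v.
have Pnp : Pn n p by have [u [tu gu _] <-] := Pp; exists u.
have Pq : Pn n q <-> Pcor n q'.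
  rewrite qE; split => [[u [tu gu] uE]|[u [tu gu _] <-]]; last first.
    exists (shift s u); last by rewrite shift_proj_class.
    by split; [apply: shift_twisted|apply: shift_generic].
  have q'E : q' = proj_class (shift (- s) u).
    by rewrite -shift_proj_class uE shift_class_comp addNr shift_class0.
  exists (shift (- s) u) => //.
  have gu' : generic (shift (- s) u) by apply: shift_generic.
  have [v pv vw] : q' (shift (- s) u) by rewrite q'E; apply: proj_class_refl.
  have [_ gv cv] := pP _ pv.
  split => //; first exact: shift_twisted.
  exact: (corrugated_map_corrugated d_gt1 gv cv vw).
have -> : `[< Pn n p /\ Pn n q >] = `[< Pcor n p /\ Pcor n q' >].
  by apply: asbool_equiv_eq; split => -[_ /Pq].
by case: asbool => //=; congr Some; apply: qE.
Qed.

End Flats.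

Theorem theorem0p2 (R : realType) (d n : nat) (hd : (2 <= d)%N) :
  (forall m : nat, (1 <= m <= d - 1)%N ->
     exists s : int,
       (forall v : polygon R d, twisted n v -> generic v -> corrugated v ->
          exists2 w : polygon R d,
            corrugated_map v = Some w & dented_map m v = Some (shift s w)) /\
       (forall p : set (polygon R d), Pcor n p ->
          T_dented n m p = omap (shift_class s) (T_cor n p))) /\
  (forall m m' : nat, (1 <= m <= d - 1)%N -> (1 <= m' <= d - 1)%N ->
     exists s : int,
       (forall v : polygon R d, twisted n v -> generic v -> corrugated v ->
          dented_map m v = omap (shift s) (dented_map m' v)) /\
       (forall p : set (polygon R d), Pcor n p ->
          T_dented n m p = omap (shift_class s) (T_dented n m' p))).
Proof.
have bounds m : (1 <= m <= d - 1)%N -> (0 < m < d)%N by lia.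
split => [m /bounds mP|m m' /bounds mP /bounds m'P].
  exists (m%:Z - 1); split => [v _ gv cv|p]; last exact: T_dented_T_cor.
  have [w vw _] := corrugated_map_defined hd gv cv.
  by exists w => //; apply: (dented_map_corrugated hd gv cv).
exists (m%:Z - m'%:Z).
have shiftE : m%:Z - m'%:Z + (m'%:Z - 1) = m%:Z - 1 by rewrite addrA subrK.
split => [v _ gv cv|p Pp].
  have [w vw _] := corrugated_map_defined hd gv cv.
  rewrite (dented_map_corrugated hd gv cv mP vw).
  by rewrite (dented_map_corrugated hd gv cv m'P vw) /= shift_comp shiftE.
rewrite !T_dented_T_cor //; case: (T_cor n p) => //= q.
by rewrite shift_class_comp shiftE.
Qed.
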